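(* Let $n>2$ be an integer and $r\ge1$ an integer with $2^r+1<2^n$, let $s_i=(2^r+1)2^{n+i}+1$ for $i\in\mathbb{N}$, and let $S=P_{2^r+1}(n)$. Then $$\mathrm{PF}(S)=\{2s_i+s_{i+1}+\dots+s_{n+r-1}-s_0\mid 1\le i\le r\}\cup\{2s_j+s_{j+1}+\dots+s_{n-1}+s_{n+r}-s_0\mid 1\le j\le n-2\}\cup\{2s_1+s_n+s_{n+r}-s_0\},$$ and the type of $S$ is $\mathrm{t}(S)=|\mathrm{PF}(S)|=n+r-1$.
   Context: $P_{2^r+1}(n)$ is the numerical semigroup consisting of all finite non-negative integer linear combinations of $\{(2^r+1)2^{n+i}+1\mid i\in\mathbb{N}\}$. An integer $x$ is a pseudo-Frobenius number of a numerical semigroup $S$ if $x\in\mathbb{Z}\setminus S$ and $x+s\in S$ for all $s\in S\setminus\{0\}$; $\mathrm{PF}(S)$ is the set of pseudo-Frobenius numbers and its cardinality $\mathrm{t}(S)$ is the type of $S$. *)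

(* Defs.v *)
From mathcomp Require Import all_boot all_order all_algebra.
From mathcomp Require Import finmap.
From mathcomp Require Import boolp classical_sets cardinality.

Set Implicit Arguments.
Unset Strict Implicit.
Unset Printing Implicit Defensive.

Import GRing.Theory.

Local Open Scope classical_set_scope.
Local Open Scope ring_scope.

(* A pair p in the list l is a coefficient p.1 with a generator p.2. *)
Definition submonoid_gen (A : set nat) : set nat :=
  [set x | exists2 l : seq (nat * nat),
     forall p, p \in l -> A p.2 & x = (\sum_(p <- l) p.1 * p.2)%N].

Definition sgen (m n i : nat) : nat := (m * 2 ^ (n + i) + 1)%N.

Definition P (m n : nat) : set nat := submonoid_gen (range (sgen m n)).

(* Pseudo-Frobenius numbers may be negative (-1 for the semigroup of all
   naturals), so a semigroup is seen inside int through Posz. *)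
Definition PF (S : set nat) : set int :=
  [set x : int | ~ (Posz @` S) x /\
     forall s : nat, S s -> s <> 0%N -> (Posz @` S) (x + s%:Z)].

(* fset_set is the empty set on infinite sets; PF S is finite whenever S is a
   numerical semigroup. *)
Definition semigroup_type (S : set nat) : nat := #|` fset_set (PF S)|%fset.

(* Main.v *)
Require Import Defs.
From mathcomp Require Import all_boot all_order all_algebra.
From mathcomp Require Import finmap zify.
From mathcomp Require Import boolp classical_sets cardinality.

(** Put [M = (2^r+1) 2^n], so that [s_i = M 2^i + 1], and let [e V] be the
    exponent of 2 in [V!], that is, [V] minus its number of binary digits 1.
    A sum of [k] generators is [M V + k = (M+1) V - (V - k)] where [V] is a sum
    of [k] powers of two, which is possible exactly when [V - k <= e V].  Hence,
    for [0 <= u <= M], the integer [(M+1) W - u] is in [S] if and only if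
    [W >= 0] and [u <= e W].  So [(M+1) (T-1) - u] is pseudo-Frobenius when
    [e (T-1) < u <= e T] and [u + 2^i - 1 <= e (T-1 + 2^i)] for all [i > 0] with
    [u + 2^i <= M + 1].  If [2^v] is the largest power of two dividing [T], the
    condition fails at [i = v], so [u + 2^v > M + 1]; this leaves only
    [T = 2^(n+r)], [T = M] and [T = M + 4]. *)

(** * Exponent of 2 in factorials *)

Definition logfact2 (m : nat) : nat := logn 2 m`!.
Arguments logfact2 : simpl never.

Lemma logfact2_0 : logfact2 0 = 0. Proof. by []. Qed.

Lemma logfact2_1 : logfact2 1 = 0. Proof. by []. Qed.

Lemma logfact2S m : logfact2 m.+1 = logn 2 m.+1 + logfact2 m.
Proof. by rewrite /logfact2 factS lognM ?fact_gt0. Qed.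

Lemma leq_logfact2D a b : logfact2 a + logfact2 b <= logfact2 (a + b).
Proof.
have h := bin_fact (leq_addr b a); rewrite addKn in h.
by rewrite /logfact2 -h !lognM ?muln_gt0 ?fact_gt0 ?bin_gt0 ?leq_addr ?leq_addl.
Qed.

Lemma leq_logfact2 : {homo logfact2 : a b / a <= b}.
Proof.
by move=> a b /subnKC <-; apply: leq_trans (leq_logfact2D _ _); apply: leq_addr.
Qed.

Lemma logn2_odd m : odd m -> logn 2 m = 0.
Proof. by move=> om; apply: logn_coprime; rewrite coprime2n. Qed.

Lemma logfact2_doubleS m : logfact2 m.*2.+1 = logfact2 m.*2.
Proof. by rewrite logfact2S logn2_odd //= odd_double. Qed.

Lemma logfact2_double m : logfact2 m.*2 = m + logfact2 m.
Proof.
elim: m => // m IH; rewrite doubleS logfact2S logfact2_doubleS IH logfact2S.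
by rewrite -doubleS -mul2n lognM // (_ : logn 2 2 = 1) //; lia.
Qed.

Lemma logfact2_le m : logfact2 m <= m.-1.
Proof.
elim/ltn_ind: m => m IH; rewrite -{1}(odd_double_half m).
have := odd_double_half m; have := IH m./2.
case: (odd m) => /=; rewrite ?add1n ?add0n ?logfact2_doubleS ?logfact2_double.
  by case: (m./2) => [|k] h e; [case: m IH e h|have := h _; lia].
by case: (m./2) => [|k] h e; [case: m IH e h|have := h _; lia].
Qed.

Lemma logfact2_ge m : m <= (logfact2 m).*2.+1.
Proof.
rewrite -{1 2}(odd_double_half m).
case: (odd m); rewrite ?add1n ?add0n ?logfact2_doubleS ?logfact2_double; lia.
Qed.

(** The binary digits of [2 ^ v * a + b] are those of [a] followed by those of [b], so the numbers
    of digits 1 add up. *)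
Lemma logfact2_block v a b :
  b < 2 ^ v -> logfact2 (2 ^ v * a + b) + a = logfact2 a + 2 ^ v * a + logfact2 b.
Proof.
elim: v a b => [|v IH] a b; first by
  rewrite expn0 mul1n; case: b => // _; rewrite logfact2_0 !addn0; lia.
rewrite -{1 2 3}(odd_double_half b) expnS => hb.
have /IH : b./2 < 2 ^ v by lia.
move=> /(_ a).
have -> : 2 * 2 ^ v * a + (odd b + b./2.*2) = odd b + (2 ^ v * a + b./2).*2.
  by rewrite -muln2 -mulnA; lia.
case: (odd b); rewrite ?add1n ?add0n ?logfact2_doubleS ?logfact2_double; lia.
Qed.

Lemma logfact2_exp v : logfact2 (2 ^ v) = (2 ^ v).-1.
Proof.
have := @logfact2_block v 1 0; rewrite expn_gt0 /= => /(_ isT).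
by rewrite muln1 logfact2_0 logfact2_1 !addn0; lia.
Qed.

Lemma logfact2_exp_pred v : logfact2 (2 ^ v).-1 + v.+1 = 2 ^ v.
Proof.
have := logfact2_exp v; case: (2 ^ v) (expn_gt0 2 v) (pfactorK v (isT : prime 2)) => //= k _ h.
rewrite logfact2S h; lia.
Qed.

(** For [u <= m./2], take [u] twos and [m - u.*2] ones. Otherwise double the powers found for [m./2]
    and [u - m./2], and add a 1 when [m] is odd. *)
Lemma sum_pow2_of_logfact2 m u : u <= logfact2 m ->
  exists l : seq nat, size l + u = m /\ \sum_(i <- l) 2 ^ i = m.
Proof.
elim/ltn_ind: m u => m IH u hu.
have e := odd_double_half m.
have [h|h] := leqP u m./2.
  exists (nseq u 1 ++ nseq (m - u.*2) 0); rewrite size_cat !size_nseq big_cat /=.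
  by rewrite !big_nseq !iter_addn; lia.
have em : logfact2 m = m./2 + logfact2 m./2.
  by rewrite -{1}e; case: (odd m); rewrite /= ?logfact2_doubleS ?logfact2_double.
have lm : m./2 < m by have := logfact2_le m; lia.
have [|l [sl el]] := IH _ lm (u - m./2); first by lia.
exists (map S l ++ nseq (odd m) 0); rewrite size_cat size_map size_nseq.
rewrite big_cat big_map big_nseq iter_addn /=.
under eq_bigr do rewrite expnS.
rewrite -big_distrr /= el; lia.
Qed.

(** * Membership in the semigroup *)

Lemma sgenE m n i : sgen m n i = m * 2 ^ n * 2 ^ i + 1.
Proof. by rewrite /sgen expnD mulnA. Qed.

Lemma P_sgen m n i : P m n (sgen m n i).
Proof.
exists [:: (1, sgen m n i)]; last by rewrite big_seq1 mul1n.
by move=> p; rewrite inE => /eqP -> /=; exists i.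
Qed.

Lemma P_add m n x y : P m n x -> P m n y -> P m n (x + y).
Proof.
move=> [l hl ->] [l' hl' ->]; exists (l ++ l'); last by rewrite big_cat.
by move=> p; rewrite mem_cat => /orP[/hl|/hl'].
Qed.

Lemma P_nonzero m n x : P m n x -> x <> 0 ->
  exists i y, P m n y /\ x = sgen m n i + y.
Proof.
case=> l; elim: l x => [|[c g] l IH] x hl ->; first by rewrite big_nil.
rewrite big_cons /=; have hl' p : p \in l -> range (sgen m n) p.2.
  by move=> pl; apply: hl; rewrite inE pl orbT.
case: c hl => [|c] hl nz; first by rewrite mul0n in nz *; exact: IH.
have [i _ /= gi] := hl _ (mem_head _ _).
exists i, (c * g + \sum_(p <- l) p.1 * p.2); split; last by rewrite gi; lia.
apply: P_add; last by exists l.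
exists [:: (c, g)]; last by rewrite big_seq1.
by move=> p; rewrite inE => /eqP -> /=; exists i.
Qed.

Lemma P_logfact2 m n x :
  P m n x <-> exists V u, u <= logfact2 V /\ x + u = (m * 2 ^ n).+1 * V.
Proof.
split.
  case=> l; elim: l x => [|[c g] l IH] x hl ->.
    by exists 0, 0; rewrite big_nil muln0.
  have [i _ /= gi] := hl _ (mem_head _ _).
  have [|V [u [uV e]]] := IH (\sum_(p <- l) p.1 * p.2) _ erefl.
    by move=> p pl; apply: hl; rewrite inE pl orbT.
  have := @logfact2_block i c 0; rewrite expn_gt0 /= => /(_ isT).
  rewrite logfact2_0 !addn0 => ei.
  have hi := expn_gt0 2 i.
  (* The [c] copies of [s_i] contribute [c] powers [2 ^ i], of sum [2 ^ i * c], hence the deficit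
     [2 ^ i * c - c]. *)
  exists (2 ^ i * c + V), (2 ^ i * c - c + u); split.
    by apply: leq_trans (leq_logfact2D _ _); lia.
  rewrite big_cons /= -gi sgenE (mulnDr _.+1) -e.
  by move: (2 ^ i) (m * 2 ^ n) (\sum_(p <- l) _) hi => k M s hk; nia.
move=> [V [u [uV e]]].
have [l [sl el]] := sum_pow2_of_logfact2 _ _ uV.
exists [seq (1, sgen m n i) | i <- l].
  by move=> p /mapP[i _ ->] /=; exists i.
rewrite big_map /=.
under eq_bigr do rewrite mul1n sgenE.
rewrite big_split /= -big_distrr /= el sum1_size; lia.
Qed.

Lemma P_normal m n x W u : u <= m * 2 ^ n -> x + u = (m * 2 ^ n).+1 * W ->
  P m n x <-> u <= logfact2 W.
Proof.
move: (@P_logfact2 m n x); move: (m * 2 ^ n) => M PE uM e; split; last first.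
  by move=> h; apply/PE; exists W, u.
move=> /PE [V [u' [u'V e']]].
have [VW|WV|VW] := ltngtP V W; last by rewrite -VW in e *; lia.
  by have := leq_mul (leqnn M.+1) VW; lia.
rewrite leqNgt; apply/negP => h.
(* Here [u'] exceeds [u] by [(M + 1) * (t + 1)]; the bounds [W <= 2 * u - 1], [u' <= V - 1] and
   [u <= M] leave no room for that. *)
have := logfact2_ge W; have := logfact2_le V => h1 h2.
have [t et] : exists t, V = W + t.+1 by exists (V - W).-1; lia.
have : u' = u + M.+1 * t.+1 by rewrite et in e'; lia.
nia.
Qed.

(** * Pseudo-Frobenius numbers as pairs *)

(* [u] and [Q] encode the pseudo-Frobenius number [(M + 1) Q - u]. *)
Definition pf_pair M Q u :=
  [/\ logfact2 Q < u, u <= logfact2 Q.+1, u <= M &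
      forall i, 0 < i -> u + 2 ^ i <= M.+1 ->
        u + 2 ^ i <= (logfact2 (Q + 2 ^ i)).+1].

(** Testing generators is enough, since a nonzero element is a generator plus an element. Adding
    [s_i] turns [(Q, u)] into [(Q + 2 ^ i, u + 2 ^ i - 1)], which [P_normal] decides as long as
    [u + 2 ^ i <= M + 1]. *)
Lemma PF_P m n (x : int) : 0 < m ->
  PF (P m n) x <-> exists Q u, pf_pair (m * 2 ^ n) Q u /\
    (x + u%:Z = ((m * 2 ^ n).+1 * Q)%N%:Z)%R.
Proof.
move=> m0; have M0 : 0 < m * 2 ^ n by rewrite muln_gt0 m0 expn_gt0.
have s0 i : sgen m n i <> 0 by rewrite sgenE; lia.
have sM i : sgen m n i + (2 ^ i).-1 = (m * 2 ^ n).+1 * 2 ^ i.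
  by rewrite sgenE; have := expn_gt0 2 i; nia.
have Pn := @P_normal m n.
have Ps := @P_sgen m n.
split.
  move=> [xN xS].
  have xsS i (y : nat) : (x + (sgen m n i)%:Z = y%:Z)%R -> P m n y.
    have [z zS <-] := xS _ (Ps i) (s0 i).
    by move=> [<-].
  (* No negative number qualifies: adding [s_0], or [s_1] to [-(M + 1)], gives a negative number or
     [(M + 1) - u] with [0 < u <= M], outside the semigroup because [logfact2 1 = 0]. *)
  case: x xN xS xsS => x xN xS xsS; last first.
    have [y yS ey] := xS _ (Ps 0) (s0 0); rewrite sgenE in ey.
    have [h|h] := ltnP x (m * 2 ^ n).
      have [|h1 _] := Pn y 1 x.+1 h; first by lia.
      by have := h1 yS; rewrite logfact2_1.
    have [|h1 _] := Pn (m * 2 ^ n) 1 1 M0; first by lia.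
    have := h1 (xsS 1 _ _); rewrite logfact2_1 sgenE; lia.
  have [Q [u [uM e]]] : exists Q u, u <= m * 2 ^ n /\ x + u = (m * 2 ^ n).+1 * Q.
    have ex := divn_eq x (m * 2 ^ n).+1.
    have lx : x %% (m * 2 ^ n).+1 < (m * 2 ^ n).+1 by rewrite ltn_mod.
    move: (x %/ _) (x %% _) ex lx => q [|d] ex lx; first by exists q, 0; lia.
    by exists q.+1, ((m * 2 ^ n).+1 - d.+1); split; [lia | nia].
  exists Q, u; split; last by lia.
  split=> //.
  - rewrite ltnNge; apply/negP => h; apply: xN; exists x => //.
    exact/(Pn _ _ _ uM e).
  - have [|h1 _] := Pn (x + sgen m n 0) Q.+1 u uM; last by apply: h1; apply: (xsS 0).
    by have := sM 0; rewrite expn0; lia.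
  - move=> i i0 hi.
    have pi := expn_gt0 2 i.
    have si := sM i.
    have [||h1 _] := Pn (x + sgen m n i) (Q + 2 ^ i) (u + (2 ^ i).-1); [lia|lia|].
    by have := h1 (xsS i _ erefl); lia.
move=> [Q [u [[lQ uQ uM hu] e]]].
have Q0 : 0 < Q by case: Q lQ uQ {e hu} => //; rewrite logfact2_1; lia.
have [x' ex] : exists x' : nat, x = x'.
  by exists ((m * 2 ^ n).+1 * Q - u); nia.
rewrite {}ex in e *.
have {}e : x' + u = (m * 2 ^ n).+1 * Q by lia.
split=> [[y yS [ey]]|s sS sn0].
  by move: yS; rewrite ey => /(Pn _ _ _ uM e); lia.
have [i [y [yS ->]]] := P_nonzero _ _ _ sS sn0.
exists (x' + (sgen m n i + y)) => //.
rewrite addnA; apply: P_add => //.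
have pi := expn_gt0 2 i; have si := sM i.
have [h|h] := leqP (u + 2 ^ i) (m * 2 ^ n).+1.
  have [||_] := Pn (x' + sgen m n i) (Q + 2 ^ i) (u + (2 ^ i).-1); [lia|lia|].
  apply.
  case: i pi {si} h => [|i] pi h; first by rewrite addn0 addn1.
  by have := hu i.+1 isT h; lia.
(* Superadditivity of [logfact2] makes the condition void for these [i]. *)
apply/P_logfact2; exists (Q.-1 + 2 ^ i), (u + (2 ^ i).-1 - (m * 2 ^ n).+1); split.
  by apply: leq_trans (leq_logfact2D _ _); rewrite logfact2_exp; lia.
have -> : Q.-1 + 2 ^ i = Q + 2 ^ i - 1 by lia.
rewrite mulnBr mulnDr; nia.
Qed.

(** * Classification of the pairs *)

Lemma logfact2_add_exp2_val Q v q : Q.+1 = 2 ^ v * q.*2.+1 ->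
  (logfact2 (Q + 2 ^ v)).+1 = logfact2 Q + 2 ^ v.
Proof.
have pv := expn_gt0 2 v; move=> e.
have lt : (2 ^ v).-1 < 2 ^ v by lia.
have := @logfact2_block v q.*2 _ lt; have := @logfact2_block v q.*2.+1 _ lt.
rewrite logfact2_doubleS.
(* In binary, [Q] ends in a zero followed by [v] ones, so adding [2 ^ v] creates exactly one more
   digit 1. *)
have -> : 2 ^ v * q.*2 + (2 ^ v).-1 = Q by rewrite mulnS in e; lia.
have -> : 2 ^ v * q.*2.+1 + (2 ^ v).-1 = Q + 2 ^ v by lia.
rewrite mulnS; lia.
Qed.

(* The pseudo-Frobenius number is [M T + k - s_0], a sum of [k] generators
   [s_i] whose powers [2^i] add up to [T], minus [s_0]. *)
Definition pf_shape n r T k :=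
  [\/ T = 2 ^ (n + r) /\ n < k <= n + r,
      T = (2 ^ r + 1) * 2 ^ n /\ 3 < k <= n.+1
    | T = (2 ^ r + 1) * 2 ^ n + 4 /\ k = 4].

Lemma mulnDexp2 n r : (2 ^ r + 1) * 2 ^ n = 2 ^ (n + r) + 2 ^ n.
Proof. by rewrite expnD; lia. Qed.

(** The two digits 1 of [M] stand at positions [n] and [n + r], clear of those of [b]. *)
Lemma logfact2_mulDexp2 n r b : 0 < r -> b < 2 ^ n ->
  logfact2 ((2 ^ r + 1) * 2 ^ n + b) + 2 = (2 ^ r + 1) * 2 ^ n + logfact2 b.
Proof.
move=> r0 hb; have := @logfact2_block n (2 ^ r + 1) b hb.
have : logfact2 (2 ^ r + 1) = 2 ^ r - 1.
  case: r r0 => [|r] // _.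
  by rewrite addn1 expnS mul2n logfact2_doubleS -mul2n -expnS logfact2_exp; lia.
have := expn_gt0 2 r.
rewrite [2 ^ n * _]mulnC; lia.
Qed.

Lemma logfact2_pred_mulDexp2 n r :
  logfact2 ((2 ^ r + 1) * 2 ^ n).-1 + n.+2 = (2 ^ r + 1) * 2 ^ n.
Proof.
have pn := expn_gt0 2 n; have lt : (2 ^ n).-1 < 2 ^ n by lia.
have := @logfact2_block n (2 ^ r) _ lt; rewrite logfact2_exp.
have := logfact2_exp_pred n; have := expn_gt0 2 r.
have -> : ((2 ^ r + 1) * 2 ^ n).-1 = 2 ^ n * 2 ^ r + (2 ^ n).-1 by lia.
rewrite [2 ^ n * _]mulnC; lia.
Qed.

Lemma double_lt_exp2 n : 2 < n -> n.*2 < 2 ^ n.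
Proof. by case: n => [|[|[|n]]] // _; elim: n => // n; rewrite (expnS 2 _.+3); lia. Qed.

Lemma exp2_odd_decomp T : 0 < T -> exists v q, T = 2 ^ v * q.*2.+1.
Proof.
move=> T0; have := pfactor_coprime (isT : prime 2) T0.
move=> [m]; rewrite coprime2n => om e; exists (logn 2 T), m./2.
by rewrite mulnC {1}e; congr (_ * _); have := odd_double_half m; rewrite om; lia.
Qed.

Lemma leq_add_dvd d a b : d %| a -> d %| b -> a < b -> a + d <= b.
Proof.
move=> /dvdnP[i ->] /dvdnP[j ->] h.
have ij : i < j by move: h; rewrite ltn_mul2r => /andP[].
by have := leq_mul ij (leqnn d); lia.
Qed.

(** With [k = Q.+1 - u], the conditions count binary digits 1: at least [k] in [Q], at most [k] in
    [Q.+1] and in each tested [Q + 2 ^ i]. *)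
Lemma pf_pair_shape n r Q u : 2 < n -> 0 < r < n ->
  pf_pair ((2 ^ r + 1) * 2 ^ n) Q u -> exists2 k, Q.+1 = u + k & pf_shape n r Q.+1 k.
Proof.
move=> n2 /andP[r0 rn]; case=> lQ uQ uM hu.
have n2n := @double_lt_exp2 n n2.
have eM := mulnDexp2 n r.
have eMb := fun b => @logfact2_mulDexp2 n r b r0.
have eMp := logfact2_pred_mulDexp2 n r.
have dnM : 2 ^ n %| (2 ^ r + 1) * 2 ^ n by rewrite dvdn_mull.
rewrite /pf_shape; move: (_ * 2 ^ n) uM hu eM eMb eMp dnM => M uM hu eM eMb eMp dnM.
have e2 : logfact2 2 = 1 by rewrite (@logfact2_double 1).
have e3 : logfact2 3 = 1 by rewrite (@logfact2_doubleS 1).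
have e4 : logfact2 4 = 3 by rewrite (@logfact2_double 2) e2.
have e5 : logfact2 5 = 3 by rewrite (@logfact2_doubleS 2).
have leT := @logfact2_le Q.+1; have Qu : Q.+1 = u + (Q.+1 - u) by lia.
exists (Q.+1 - u) => //; move: Qu; set k := Q.+1 - u => Qu.
have [TM|TM|TM] := ltngtP Q.+1 M.
- have [v [q eT]] := exp2_odd_decomp Q.+1 isT.
  have hv : M.+1 < u + 2 ^ v.
    rewrite ltnNge; apply/negP => h.
    case: v eT h => [|v] eT h.
      move: uQ; rewrite logfact2S logn2_odd; first by lia.
      by rewrite eT mul1n /= odd_double.
    have := hu v.+1 isT h; have := logfact2_add_exp2_val Q v.+1 q eT; lia.
  have dT : 2 ^ v %| Q.+1 by rewrite eT dvdn_mulr.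
  (* If [2 ^ v] divided [M], then [Q.+1 + 2 ^ v <= M], against [hv]; so [n < v]. *)
  have [vn|nv] := leqP v n.
    have dM : 2 ^ v %| M by apply: dvdn_trans dnM; rewrite dvdn_exp2l.
    by have := leq_add_dvd _ _ _ dT dM TM; lia.
  have vN : v <= n + r.
    rewrite leqNgt; apply/negP => h.
    have := leq_pexp2l (isT : 0 < 2) h; have := dvdn_leq (isT : 0 < Q.+1) dT.
    have := leq_pexp2l (isT : 0 < 2) (leq_addr r n); rewrite expnS; lia.
  have dN : 2 ^ v %| 2 ^ (n + r) by rewrite dvdn_exp2l.
  (* Distinct multiples of [2 ^ v] are at least [2 ^ v] apart: below [2 ^ (n + r)] this contradicts
     [hv], and above it [M] is only [2 ^ n] away. *)
  have [TN|NT|TN] := ltngtP Q.+1 (2 ^ (n + r)).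
  + by have := leq_add_dvd _ _ _ dT dN TN; lia.
  + have := leq_add_dvd _ _ _ dN dT NT.
    by have := leq_pexp2l (isT : 0 < 2) (ltnW nv); lia.
  + constructor 1; split=> //.
    have := logfact2_exp_pred (n + r); rewrite -TN /= => eN.
    (* The test at [i = n] yields [n < k], since [M - 1] has [n + 1] digits 1. *)
    have := hu n (ltnW (ltnW n2)).
    have -> : Q + 2 ^ n = M.-1 by clear -TN eM; lia.
    by clear -TN eM eN eMp Qu lQ uQ leT; lia.
- constructor 3.
  (* As [logfact2 (M + 5) = M + 1] is too large, [Q] lies between [M] and [M + 4]. The bounds on [u]
     refute [M], [M + 2] and [M + 4]; the test at [i = 1] refutes [M + 1]. *)
  have [h|h] := leqP (M + 5) Q.
    by have := leq_logfact2 _ _ h; have := eMb 5; clear -n2n n2 e5 lQ uM; lia.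
  have M0 := eMb 0; have M1 := eMb 1; have M2 := eMb 2; have M3 := eMb 3.
  have M4 := eMb 4; have := hu 1 isT; rewrite expn1 => h1.
  have n8 : 5 < 2 ^ n by clear -n2 n2n; lia.
  rewrite ?(logfact2_0, logfact2_1, e2, e3, e4) in M0 M1 M2 M3 M4.
  move: M0 M1 M2 M3 M4.
  have : Q \in [:: M; M + 1; M + 2; M + 3; M + 4] by clear -h TM; rewrite !inE; lia.
  clear -lQ uQ uM Qu h1 n8; rewrite !inE.
  move=> /or4P[/eqP|/eqP|/eqP|/orP[/eqP|/eqP]] eQ; rewrite {}eQ in lQ uQ Qu h1 *;
  rewrite !(addnS, addn0) in lQ uQ Qu h1 *; lia.
- constructor 2; split=> //.
  have eQ : Q = M.-1 by lia.
  (* The test at [i = 1] gives [k >= 3]; this makes the test at [i = 2] applicable, and that one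
     gives [k >= 4]. *)
  have := hu 1 isT; have := hu 2 isT; rewrite -TM.
  have := eMb 0; have := eMb 1; have := eMb 3.
  rewrite eQ in lQ *.
  have -> : M.-1 + 2 ^ 1 = M + 1 by lia.
  have -> : M.-1 + 2 ^ 2 = M + 3 by lia.
  rewrite TM in uQ.
  rewrite logfact2_0 logfact2_1 e3 !addn0; lia.
Qed.

Lemma pf_shape_pair n r u k : 2 < n -> 0 < r < n ->
  pf_shape n r (u + k) k -> pf_pair ((2 ^ r + 1) * 2 ^ n) (u + k).-1 u.
Proof.
move=> n2 /andP[r0 rn] sh.
have n2n := @double_lt_exp2 n n2.
have eM := mulnDexp2 n r.
have eMb := fun b => @logfact2_mulDexp2 n r b r0.
have eMp := logfact2_pred_mulDexp2 n r.
move: sh; rewrite /pf_shape.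
move: eM eMb eMp; set M := (2 ^ r + 1) * 2 ^ n => eM eMb eMp.
have e3 : logfact2 3 = 1 by rewrite (@logfact2_doubleS 1) (@logfact2_double 1).
have e4 : logfact2 4 = 3 by rewrite (@logfact2_double 2) (@logfact2_double 1).
have nN := leq_pexp2l (isT : 0 < 2) (leq_addr r n).
case=> -[eT hk].
- have eN := logfact2_exp_pred (n + r).
  rewrite eT; split; [lia| |lia|].
    by rewrite prednK ?expn_gt0 // logfact2_exp; lia.
  move=> i i0 hi; have pi := expn_gt0 2 i.
  (* From [k <= n + r] and [2 * n < 2 ^ n], [2 ^ i] stays below [2 ^ n.+1]. Then [Q + 2 ^ i] has
     [i + 1 <= k] digits 1. *)
  have lin : i <= n.
    rewrite leqNgt; apply/negP => ni.
    by have := leq_pexp2l (isT : 0 < 2) ni; rewrite expnS; lia.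
  have iN := leq_pexp2l (isT : 0 < 2) lin.
  have := @logfact2_block (n + r) 1 (2 ^ i).-1; rewrite muln1 logfact2_1.
  have -> : 2 ^ (n + r) + (2 ^ i).-1 = (2 ^ (n + r)).-1 + 2 ^ i by lia.
  by have := logfact2_exp_pred i; lia.
- rewrite eT; split; [lia| |lia|].
    have := eMb 0; rewrite logfact2_0 addn0 prednK; lia.
  move=> i i0 hi; have pi := expn_gt0 2 i.
  (* [Q + 2 ^ i] has [i + 2] digits 1, while [2 ^ i <= k + 1] and [4 <= k]. *)
  have ik : i + 2 <= k.
    have [i2|i2] := leqP i 2; last by have := double_lt_exp2 _ i2; lia.
    by clear pi; case: i i0 i2 hi => [|[|[|i]]] //; rewrite ?expn1; lia.
  have := eMb (2 ^ i).-1.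
  have -> : M + (2 ^ i).-1 = M.-1 + 2 ^ i by lia.
  by have := logfact2_exp_pred i; lia.
- have eu : u = M by lia.
  rewrite hk eu; split=> //.
  + have -> : (M + 4).-1 = M + 3 by lia.
    have := eMb 3; lia.
  + have -> : (M + 4).-1.+1 = M + 4 by lia.
    have := eMb 4; lia.
  + by move=> i i0; have := ltn_expl i (isT : 1 < 2); lia.
Qed.

Lemma PF_shape n r (x : int) : 2 < n -> 0 < r < n ->
  PF (P (2 ^ r + 1) n) x <-> exists T k, pf_shape n r T k /\
    (x = ((2 ^ r + 1) * 2 ^ n * T + k)%N%:Z - ((2 ^ r + 1) * 2 ^ n).+1%:Z)%R.
Proof.
move=> n2 hr; rewrite PF_P ?addn1 //; split.
  move=> [Q [u [pf e]]]; have := pf_pair_shape n r _ _ n2 hr.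
  rewrite addn1 => /(_ _ _ pf) [k eQ sh]; exists Q.+1, k; split=> //.
  by move: e; move: (_ * 2 ^ n) => M; rewrite mulnS; lia.
move=> [T [k [sh e]]].
have kT : 0 < k <= T.
  have := double_lt_exp2 _ n2; have := leq_pexp2l (isT : 0 < 2) (leq_addr r n).
  have := mulnDexp2 n r.
  by case: sh => -[-> ?]; lia.
exists T.-1, (T - k); split.
  have := @pf_shape_pair n r (T - k) k n2 hr; rewrite subnK; last by lia.
  by rewrite addn1; apply.
move: e; move: (_ * 2 ^ n) => M e.
have -> : T = T.-1.+1 by lia.
nia.
Qed.

(** Doubling the first term makes the powers of two collapse to [2 ^ L]; [L - i + 1] is the number
    of generators, with multiplicity. *)
Lemma sum_sgen m n i L : i < L ->
  2 * sgen m n i + \sum_(i.+1 <= k < L) sgen m n k = m * 2 ^ n * 2 ^ L + (L - i + 1).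
Proof.
elim: L => // L IH; rewrite ltnS leq_eqVlt => /orP[/eqP <-|h].
  by rewrite big_geq // sgenE expnS; lia.
by rewrite big_nat_recr //= addnA IH // sgenE expnS; lia.
Qed.

(** * The explicit list and its cardinality *)

Local Open Scope classical_set_scope.
Local Open Scope ring_scope.

Theorem theorem8 (n r : nat) (hn : (2 < n)%N) (hr : (1 <= r)%N)
    (hrn : (2 ^ r + 1 < 2 ^ n)%N) :
  let s := sgen (2 ^ r + 1)%N n in
  let S := P (2 ^ r + 1)%N n in
  PF S =
    [set (2 * s i + \sum_(i.+1 <= k < n + r) s k)%N%:Z - (s 0%N)%:Z
      | i in [set i : nat | (1 <= i <= r)%N]]
    `|` [set (2 * s j + \sum_(j.+1 <= k < n) s k + s (n + r))%N%:Z
             - (s 0%N)%:Z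
      | j in [set j : nat | (1 <= j <= n - 2)%N]]
    `|` [set (2 * s 1 + s n + s (n + r))%N%:Z - (s 0%N)%:Z]
  /\ semigroup_type S = (n + r - 1)%N.
Proof.
move=> s S.
have rn : (0 < r < n)%N.
  rewrite hr /= ltnNge; apply/negP => h.
  by have := leq_pexp2l (isT : 0 < 2)%N h; lia.
have PFE x := @PF_shape n r x hn rn.
have n2n := double_lt_exp2 _ hn.
have eM := mulnDexp2 n r.
have Nn : (2 * 2 ^ n <= 2 ^ (n + r))%N.
  by rewrite -expnS; apply: leq_pexp2l => //; lia.
have sE i : s i = ((2 ^ r + 1) * 2 ^ n * 2 ^ i + 1)%N by rewrite /s sgenE.
have sumE := @sum_sgen (2 ^ r + 1) n.
move: PFE; rewrite /pf_shape -/S.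
move: eM sE sumE; set M := ((2 ^ r + 1) * 2 ^ n)%N => eM sE sumE PFE.
split.
  apply/seteqP; split=> x.
    move=> /PFE [T [k [[] [-> hk] ->]]].
    (* The index solves [k = n + r - i + 1], from [sum_sgen] with [L = n + r]. In the next family
       [L = n] and the extra [s (n + r)] give [k = n - j + 2]. *)
    - left; left; exists (n + r - k + 1)%N => /=; first by lia.
      by rewrite sumE ?sE ?expn0; lia.
    - left; right; exists (n + 2 - k)%N => /=; first by lia.
      by rewrite sumE ?sE ?expn0; lia.
    - by right; rewrite /= !sE expn1 expn0 hk; lia.
  move=> [[[i /= hi <-]|[j /= hj <-]]|/= ->]; apply/PFE.
  - exists (2 ^ (n + r))%N, (n + r - i + 1)%N; split; first by constructor 1; lia.
    by rewrite sumE ?sE ?expn0; lia.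
  - exists M, (n - j + 2)%N; split; first by constructor 2; lia.
    by rewrite sumE ?sE ?expn0; lia.
  - exists (M + 4)%N, 4%N; split; first by constructor 3.
    by rewrite !sE expn1 expn0; lia.
(* The admissible pairs [(T, k)] form families of sizes [r], [1] and [n - 2]. *)
pose z (p : nat * nat) : int := (M * p.1 + p.2)%N%:Z - M.+1%:Z.
pose l := [seq ((2 ^ (n + r))%N, k) | k <- iota n.+1 r] ++
          ((M + 4, 4)%N :: [seq (M, k) | k <- iota 4 (n - 2)]).
have lP T k : (T, k) \in l <-> [\/ T = (2 ^ (n + r))%N /\ (n < k <= n + r)%N,
    T = M /\ (3 < k <= n.+1)%N | T = (M + 4)%N /\ k = 4].
  rewrite mem_cat inE; split.
    case/or3P => [/mapP[i]|/eqP[-> ->]|/mapP[i]].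
    - by rewrite mem_iota => hi [-> ->]; constructor 1; lia.
    - by constructor 3.
    - by rewrite mem_iota => hi [-> ->]; constructor 2; lia.
  case=> -[-> hk]; apply/or3P.
  - by constructor 1; apply: map_f; rewrite mem_iota; lia.
  - by constructor 3; apply: map_f; rewrite mem_iota; lia.
  - by constructor 2; rewrite hk.
(* Since [k < M], [k] is the remainder of [M * T + k] modulo [M], so distinct pairs give distinct
   numbers. *)
have lM T k : (T, k) \in l -> (k < M)%N by move=> /lP []; lia.
rewrite /semigroup_type.
have -> : PF S = [set` [fset x in map z l]%fset].
  apply/seteqP; split=> x /=; rewrite inE /=.
    by move=> /PFE [T [k [/lP h ->]]]; apply/mapP; exists (T, k).
  by move=> /mapP[[T k] /lP h ->]; apply/PFE; exists T, k.
rewrite set_fsetK card_fseq undup_id.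
  by rewrite size_map size_cat /= !size_map !size_iota; lia.
rewrite map_inj_in_uniq => [|[T k] [T' k'] /lM hk /lM hk' /= h].
  rewrite cat_uniq cons_uniq !map_inj_uniq ?iota_uniq; try by move=> ? ? [].
  rewrite andbT andTb; apply/andP; split; last by apply/mapP => -[j _ []]; lia.
  rewrite -all_predC; apply/allP => -[T k]; rewrite inE => h.
  apply/mapP => -[j _ [eT _]].
  by case/orP: h => [/eqP[]|/mapP[i _ []]]; lia.
have e : (M * T + k = M * T' + k')%N by move: h; rewrite /z /=; lia.
have eT : T = T'.
  by move: (congr1 (divn^~ M) e); rewrite /= ![(M * _)%N]mulnC !divnMDl ?divn_small ?addn0 //; lia.
by move: e; rewrite eT => /addnI ->.
Qed.
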